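(* Let $\mathcal{G}$ be a groupoid and let $\mathcal{R}$ be a unital ring bundle over $\mathcal{G}^{(0)}$. For two factor systems $(M,\tau),(M',\tau')\in Z^2(\mathcal{G},\mathcal{R})$ the following conditions are equivalent: (i) $\mathcal{R}\times_{(M,\tau)}\mathcal{G}$ and $\mathcal{R}\times_{(M',\tau')}\mathcal{G}$ are equivalent $\mathcal{G}$-crossed products over $R$. (ii) $(M,\tau)\sim(M',\tau')$, i.e. there exists $h\in C^1(\mathcal{G},\mathcal{R}^\times)$ such that $(M',\tau')=h.(M,\tau)$. If these conditions are satisfied, with $h$ as in (ii), then the map $$\psi:\mathcal{R}\times_{(M',\tau')}\mathcal{G}\to\mathcal{R}\times_{(M,\tau)}\mathcal{G},\qquad (n,x)\mapsto(nh(x),x),$$ where $(n,x)$ denotes the homogeneous element supported at $x\in\mathcal{G}$ with value $n\in R_{r(x)}$ (so that $\psi(f)(x)=f(x)h(x)$), is an equivalence of $\mathcal{G}$-crossed products over $R$; further, all equivalences of $\mathcal{G}$-crossed products over $R$ from $\mathcal{R}\times_{(M',\tau')}\mathcal{G}$ to $\mathcal{R}\times_{(M,\tau)}\mathcal{G}$ are of this form for some such $h$.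
   Context: Groupoids are purely algebraic. A groupoid $\mathcal{G}$ has unit space $\mathcal{G}^{(0)}\subseteq\mathcal{G}$ and range and source maps $r,s$; $xy$ is defined iff $s(x)=r(y)$; $\mathcal{G}^{(n)}$ is the set of $n$-tuples with $s(x_i)=r(x_{i+1})$. Rings are associative. A unital ring bundle $\mathcal{R}$ over $\mathcal{G}^{(0)}$ is a set with a map to $\mathcal{G}^{(0)}$ whose fibres $R_u$ are unital rings; $\mathcal{R}^\times:=\bigcup_uR_u^\times$ and $R:=\bigoplus_{u\in\mathcal{G}^{(0)}}R_u$. Factor systems. A factor system for $(\mathcal{G},\mathcal{R})$ is a pair $(M,\tau)$ consisting of ring isomorphisms $M_x:R_{s(x)}\to R_{r(x)}$, $x\in\mathcal{G}$, with $M_u=\mathrm{id}_{R_u}$ for $u\in\mathcal{G}^{(0)}$, and a map $\tau:\mathcal{G}^{(2)}\to\mathcal{R}^\times$ with $\tau(x,y)\in R_{r(x)}^\times$ and $\tau(x,s(x))=\tau(r(x),x)=1_{R_{r(x)}}$, such that $M_xM_y(n)=\tau(x,y)M_{xy}(n)\tau(x,y)^{-1}$ for $(x,y)\in\mathcal{G}^{(2)}$, $n\in R_{s(y)}$, and $\tau(x,y)\tau(xy,z)=M_x(\tau(y,z))\tau(x,yz)$ for $(x,y,z)\in\mathcal{G}^{(3)}$. $Z^2(\mathcal{G},\mathcal{R})$ is the set of factor systems. $C^1(\mathcal{G},\mathcal{R}^\times)$ is the group (pointwise product) of maps $h:\mathcal{G}\to\mathcal{R}^\times$ with $h(x)\in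 R_{r(x)}^\times$ and $h(u)=1_{R_u}$ for $u\in\mathcal{G}^{(0)}$; it acts on $Z^2(\mathcal{G},\mathcal{R})$ by $h.(M,\tau)=(h.M,h.\tau)$ with $(h.M)_x(n)=h(x)M_x(n)h(x)^{-1}$ and $(h.\tau)(x,y)=h(x)M_x(h(y))\tau(x,y)h(xy)^{-1}$. Crossed products. $\mathcal{R}\times_{(M,\tau)}\mathcal{G}$ is the ring of finitely supported functions $f:\mathcal{G}\to\mathcal{R}$ with $f(x)\in R_{r(x)}$, with pointwise sum and product $(fg)(z)=\sum_{xy=z}f(x)M_x(g(y))\tau(x,y)$. It is graded by $\mathcal{G}$, the component at $x$ being the functions supported in $\{x\}$, and the subring of functions supported in $\mathcal{G}^{(0)}$ is identified with $R$. It is a $\mathcal{G}$-crossed product over $R$. Two $\mathcal{G}$-crossed products $S,S'$ over $R$ are equivalent if there is a graded ring isomorphism $\phi:S\to S'$ with $\phi|_R=\mathrm{id}_R$; such a $\phi$ is called an equivalence. *)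

(* Defs.v *)
From HB Require Import structures.
From mathcomp Require Import all_boot all_algebra.
From mathcomp Require Import all_classical.
Set Implicit Arguments.
Unset Strict Implicit.
Unset Printing Implicit Defensive.
Import GRing.Theory.
Local Open Scope classical_set_scope.
Local Open Scope ring_scope.

(* [hom u v] is the set of x with r(x) = u and s(x) = v.  Hence x * y is defined
   exactly when x : hom u v and y : hom v w, and the sets of composable pairs
   and triples need no separate encoding. *)
Record groupoid := Groupoid {
  obj : Type;
  hom : obj -> obj -> Type;
  gone : forall u, hom u u;
  gmul : forall u v w, hom u v -> hom v w -> hom u w;
  ginv : forall u v, hom u v -> hom v u;
  gmulA : forall u v w t (x : hom u v) (y : hom v w) (z : hom w t),
    gmul x (gmul y z) = gmul (gmul x y) z;
  gmul1g : forall u v (x : hom u v), gmul (gone u) x = x;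
  gmulg1 : forall u v (x : hom u v), gmul x (gone v) = x;
  gmulVg : forall u v (x : hom u v), gmul (ginv x) x = gone v;
  gmulgV : forall u v (x : hom u v), gmul x (ginv x) = gone u }.

Arguments gone {g} u.
Arguments gmul {g u v w} x y.
Arguments ginv {g u v} x.

Declare Scope gpd_scope.
Delimit Scope gpd_scope with gpd.
Notation "x * y" := (gmul x y) : gpd_scope.
Notation "x ^-1" := (ginv x) : gpd_scope.

Definition arrow (G : groupoid) : choiceType :=
  {classic {u : obj G & {v : obj G & hom u v}}}.

Definition arr (G : groupoid) (u v : obj G) (x : hom u v) : arrow G :=
  existT _ u (existT _ v x).

Definition unit_space (G : groupoid) : set (arrow G) :=
  range (fun u : obj G => arr (gone u)).

(* [pzRingType] is used throughout since the zero ring is a unital ring; the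
   library's [unitRingType] excludes it.  A unit is stored together with its
   inverse. *)
Section Units.
Variable A : pzRingType.

Record units := Units {
  uprod : A * A;
  uprodP : (uprod.1 * uprod.2 == 1) && (uprod.2 * uprod.1 == 1) }.

HB.instance Definition _ := [isSub for uprod].
HB.instance Definition _ := [Choice of units by <:].

Definition uval (a : units) : A := (uprod a).1.
Definition uinv (a : units) : A := (uprod a).2.

Lemma uvalK (a : units) : uval a * uinv a = 1.
Proof. by case/andP: (uprodP a) => /eqP. Qed.

Lemma uinvK (a : units) : uinv a * uval a = 1.
Proof. by case/andP: (uprodP a) => _ /eqP. Qed.

Lemma uval_inj : injective uval.
Proof.
move=> a b eab; apply: val_inj => /=; rewrite [LHS]surjective_pairing.
rewrite [RHS]surjective_pairing -/(uval a) -/(uval b) eab; congr pair.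
rewrite -/(uinv a) -/(uinv b) -[LHS]mulr1 -(uvalK b) mulrA -eab.
by rewrite uinvK mul1r.
Qed.

Definition mkUnits (a b : A) (ab : a * b = 1) (ba : b * a = 1) : units.
Proof. by exists (a, b); rewrite /= ab ba !eqxx. Defined.

Definition units_one : units := mkUnits (mulr1 1) (mulr1 1).

Definition units_mul (a b : units) : units.
Proof.
apply: (@mkUnits (uval a * uval b) (uinv b * uinv a)).
- by rewrite mulrA -(mulrA (uval a)) uvalK mulr1 uvalK.
- by rewrite mulrA -(mulrA (uinv b)) uinvK mulr1 uinvK.
Defined.

Definition units_inv (a : units) : units := mkUnits (uinvK a) (uvalK a).

Let units_mulA : associative units_mul.
Proof. by move=> a b c; apply: uval_inj; rewrite /= /uval /= mulrA. Qed.
Let units_mul1 : left_id units_one units_mul.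
Proof. by move=> a; apply: uval_inj; rewrite /uval /= mul1r. Qed.
Let units_mulr1 : right_id units_one units_mul.
Proof. by move=> a; apply: uval_inj; rewrite /uval /= mulr1. Qed.
Let units_mulV : left_inverse units_one units_inv units_mul.
Proof. by move=> a; apply: uval_inj; rewrite /uval /= uinvK. Qed.
Let units_mulrV : right_inverse units_one units_inv units_mul.
Proof. by move=> a; apply: uval_inj; rewrite /uval /= uvalK. Qed.

HB.instance Definition _ :=
  isGroup.Build units units_mulA units_mul1 units_mulr1 units_mulV units_mulrV.

End Units.

Lemma uvalM (A : pzRingType) (a b : units A) :
  uval (a * b)%g = uval a * uval b.
Proof. by []. Qed.
Lemma uval1 (A : pzRingType) : uval (1%g : units A) = 1.
Proof. by []. Qed.
Lemma uvalVr (A : pzRingType) (a : units A) : uval a * uval a^-1%g = 1.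
Proof. exact: uvalK. Qed.
Lemma uvalVl (A : pzRingType) (a : units A) : uval a^-1%g * uval a = 1.
Proof. exact: uinvK. Qed.

Record ring_iso (A B : pzRingType) := RingIso {
  iso_rmor :> {rmorphism A -> B};
  iso_bij : bijective iso_rmor }.

Lemma ring_iso_eq (A B : pzRingType) (f g : ring_iso A B) : f =1 g -> f = g.
Proof.
case: f g => [f bf] [g bg] /= efg; have fg : f = g.
  case: f g efg {bf bg} => [f cf] [g cg] /= /funext efg; subst g.
  congr GRing.RMorphism.Pack.
  case: cf cg => [[a1] [b1]] [[a2] [b2]].
  by congr GRing.RMorphism.Class; f_equal; apply: Prop_irrelevance.
by subst g; congr RingIso; apply: Prop_irrelevance.
Qed.

Definition units_map (A B : pzRingType) (f : {rmorphism A -> B}) (a : units A) :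
  units B.
Proof.
by apply: (@mkUnits _ (f (uval a)) (f (uval a^-1%g)));
  rewrite -rmorphM ?uvalVr ?uvalVl rmorph1.
Defined.

(* Conjugation n |-> h * f(n) * h^-1 of an isomorphism by a unit. *)
Section Conj.
Variables (A B : pzRingType) (h : units B) (f : ring_iso A B).

Definition conj_fun (n : A) : B := uval h * f n * uval h^-1%g.

Let conj_add : {morph conj_fun : x y / x - y}.
Proof. by move=> x y; rewrite /conj_fun rmorphB mulrBr mulrBl. Qed.

Let conj_mul : monoid_morphism conj_fun.
Proof.
split=> [|x y]; rewrite /conj_fun; first by rewrite rmorph1 mulr1 uvalVr.
rewrite rmorphM -[RHS]mulrA.
by rewrite (mulrA (uval h^-1%g)) (mulrA (uval h^-1%g)) uvalVl mul1r !mulrA.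
Qed.

HB.instance Definition _ := GRing.isZmodMorphism.Build A B conj_fun conj_add.
HB.instance Definition _ := GRing.isMonoidMorphism.Build A B conj_fun conj_mul.

Let conj_bij : bijective conj_fun.
Proof.
case: (iso_bij f) => g fK gK.
exists (fun n => g (uval h^-1%g * n * uval h)) => n; rewrite /conj_fun.
  by rewrite !mulrA uvalVl mul1r -mulrA uvalVl mulr1 fK.
by rewrite gK !mulrA uvalVr mul1r -mulrA uvalVr mulr1.
Qed.

Definition conj_iso : ring_iso A B := RingIso conj_bij.
End Conj.

Definition ring_bundle (G : groupoid) := obj G -> pzRingType.

Section Factor.
Variables (G : groupoid) (R : ring_bundle G).

Record factor_system := FactorSystem {
  fsM : forall u v : obj G, hom u v -> ring_iso (R v) (R u);
  fstau : forall u v w : obj G, hom u v -> hom v w -> units (R u);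
  fsM1 : forall (u : obj G) (n : R u), fsM (gone u) n = n;
  fstaug1 : forall (u v : obj G) (x : hom u v), fstau x (gone v) = 1%g;
  fstau1g : forall (u v : obj G) (x : hom u v), fstau (gone u) x = 1%g;
  fsMM : forall (u v w : obj G) (x : hom u v) (y : hom v w) (n : R w),
    fsM x (fsM y n) = 
      uval (fstau x y) * fsM (x * y)%gpd n * uval (fstau x y)^-1%g;
  fstauA : forall (u v w t : obj G) (x : hom u v) (y : hom v w) (z : hom w t),
    uval (fstau x y) * uval (fstau (x * y)%gpd z) =
    fsM x (uval (fstau y z)) * uval (fstau x (y * z)%gpd) }.

(* C^1(G, R^x) *)
Record cochain1 := Cochain1 {
  c1val : forall u v : obj G, hom u v -> units (R u);
  c1val1 : forall u : obj G, c1val (gone u) = 1%g }.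

Arguments c1val h {u v} x : rename.
Arguments fsM F {u v} x : rename.
Arguments fstau F {u v w} x y : rename.

Section Act.
Variables (h : cochain1) (F : factor_system).

Definition actM u v (x : hom u v) : ring_iso (R v) (R u) :=
  conj_iso (c1val h x) (fsM F x).

Definition acttau u v w (x : hom u v) (y : hom v w) : units (R u) :=
  (c1val h x * units_map (fsM F x) (c1val h y) * fstau F x y *
     (c1val h (x * y)%gpd)^-1)%g.

Let actM1 u (n : R u) : actM (gone u) n = n.
Proof.
rewrite /actM /= /conj_fun c1val1 fsM1 uval1 mul1r.
by rewrite -[LHS]mulr1 -mulrA uvalVl mulr1.
Qed.

Let acttaug1 u v (x : hom u v) : acttau x (gone v) = 1%g.
Proof.
rewrite /acttau fstaug1 gmulg1 c1val1 mulg1; apply: uval_inj.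
by rewrite !uvalM [uval (units_map _ _)]rmorph1 mulr1 uvalVr.
Qed.

Let acttau1g u v (x : hom u v) : acttau (gone u) x = 1%g.
Proof.
rewrite /acttau fstau1g gmul1g c1val1 mulg1 mul1g; apply: uval_inj.
by rewrite uvalM [uval (units_map _ _)]fsM1 uvalVr.
Qed.

Let actMM u v w (x : hom u v) (y : hom v w) (n : R w) :
  actM x (actM y n) = 
    uval (acttau x y) * actM (x * y)%gpd n * uval (acttau x y)^-1%g.
Proof.
have umV : uval (units_map (fsM F x) (c1val h y))^-1%g =
   fsM F x (uval (c1val h y)^-1%g) by [].
rewrite /actM /acttau /= /conj_fun !rmorphM fsMM !invgM invgK !uvalM umV.
rewrite !mulrA -[_ * uval (c1val h (x * y)%gpd)^-1%g * _]mulrA uvalVl mulr1.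
by rewrite -[_ * uval (c1val h (x * y)%gpd)^-1%g * _]mulrA uvalVl mulr1.
Qed.

Let acttauA u v w t (x : hom u v) (y : hom v w) (z : hom w t) :
  uval (acttau x y) * uval (acttau (x * y)%gpd z) =
  actM x (uval (acttau y z)) * uval (acttau x (y * z)%gpd).
Proof.
rewrite /actM /acttau /= /conj_fun !uvalM !rmorphM gmulA.
rewrite !mulrA -[_ * uval (c1val h (x * y)%gpd)^-1%g * _]mulrA uvalVl mulr1.
have -> : uval (units_map (fsM F (x * y)%gpd) (c1val h z)) =
   fsM F (x * y)%gpd (uval (c1val h z)) by [].
rewrite -[_ * uval (c1val h x)^-1%g * _]mulrA uvalVl mulr1.
have -> : uval (units_map (fsM F x) (c1val h (y * z)%gpd)) =
   fsM F x (uval (c1val h (y * z)%gpd)) by [].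
have E : fsM F x (uval (c1val h (y * z)%gpd)^-1%g) * fsM F x (uval (c1val h (y * z)%gpd))
   = 1 by rewrite -rmorphM uvalVl rmorph1.
rewrite -[_ * _ * fsM F x (uval (c1val h (y * z)%gpd))]mulrA E mulr1.
congr (_ * _); rewrite -!mulrA; congr (_ * (_ * _)).
rewrite -fstauA !mulrA; congr (_ * _).
have -> : uval (units_map (fsM F y) (c1val h z)) = fsM F y (uval (c1val h z)) by [].
by rewrite fsMM -mulrA uvalVl mulr1.
Qed.

Definition act : factor_system :=
  FactorSystem actM1 acttaug1 acttau1g actMM acttauA.

End Act.

Definition cohomologous (F F' : factor_system) := exists h, F' = act h F.

End Factor.

Arguments c1val {G R} h {u v} x : rename.
Arguments fsM {G R} F {u v} x : rename.
Arguments fstau {G R} F {u v w} x y : rename.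

(* Associative rings, not necessarily with an identity element: a crossed
   product has none when the unit space is infinite and the fibres are nonzero. *)
HB.mixin Record Zmodule_isRng V of GRing.Zmodule V := {
  rngmul : V -> V -> V;
  rngmulA : associative rngmul;
  rngmulDl : left_distributive rngmul +%R;
  rngmulDr : right_distributive rngmul +%R }.

#[short(type="rngType")]
HB.structure Definition Rng := { V of Zmodule_isRng V & GRing.Zmodule V }.

Definition rng_iso (S S' : rngType) (phi : S -> S') : Prop :=
  [/\ {morph phi : f g / f + g},
      {morph phi : f g / rngmul f g} &
      bijective phi].

Section Sections.
Variables (G : groupoid) (R : ring_bundle G).

Definition supp (f : forall u v : obj G, hom u v -> R u) : set (arrow G) :=
  [set a : arrow G | f _ _ (projT2 (projT2 a)) <> 0].

(* Finitely supported maps f on the groupoid with f(x) in R_{r(x)}. *)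
Record fsect := FSect {
  coef : forall u v : obj G, hom u v -> R u;
  coef_fin : finite_set (supp coef) }.

Arguments coef f {u v} x : rename.

Lemma fsect_eq (f g : fsect) :
  (forall u v (x : hom u v), coef f x = coef g x) -> f = g.
Proof.
case: f g => [f ff] [g fg] /= efg.
have e : f = g.
  by apply: functional_extensionality_dep => u;
     apply: functional_extensionality_dep => v; apply/funext => x.
by subst g; congr FSect; apply: Prop_irrelevance.
Qed.

HB.instance Definition _ := gen_eqMixin fsect.
HB.instance Definition _ := gen_choiceMixin fsect.

Definition fsect0 : fsect.
Proof.
exists (fun u v x => 0).
by rewrite (_ : supp _ = set0)//; apply/seteqP; split=> a.
Defined.

Definition fsect_opp (f : fsect) : fsect.
Proof.
exists (fun u v x => - coef f x); apply: sub_finite_set (coef_fin f) => a.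
by rewrite /supp /=; apply: contra_not => ->; rewrite oppr0.
Defined.

Definition fsect_add (f g : fsect) : fsect.
Proof.
exists (fun u v x => coef f x + coef g x).
have : finite_set (supp (@coef f) `|` supp (@coef g)).
  by rewrite finite_setU; split; apply: coef_fin.
apply: sub_finite_set => a; rewrite /supp /= => ne.
by apply/not_andP => -[f0 g0]; apply: ne; rewrite f0 g0 addr0.
Defined.

Let fsect_addA : associative fsect_add.
Proof. by move=> f g h; apply: fsect_eq => u v x /=; rewrite addrA. Qed.
Let fsect_addC : commutative fsect_add.
Proof. by move=> f g; apply: fsect_eq => u v x /=; rewrite addrC. Qed.
Let fsect_add0 : left_id fsect0 fsect_add.
Proof. by move=> f; apply: fsect_eq => u v x /=; rewrite add0r. Qed.
Let fsect_addN : left_inverse fsect0 fsect_opp fsect_add.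
Proof. by move=> f; apply: fsect_eq => u v x /=; rewrite addNr. Qed.

HB.instance Definition _ :=
  GRing.isZmodule.Build fsect fsect_addA fsect_addC fsect_add0 fsect_addN.

Lemma coefD (f g : fsect) u v (x : hom u v) : coef (f + g) x = coef f x + coef g x.
Proof. by []. Qed.

End Sections.

Arguments coef {G R} f {u v} x : rename.

(* The underlying group of the crossed product by F = (M, tau); it does not
   depend on F, but its multiplication does. *)
Definition cprod (G : groupoid) (R : ring_bundle G) (F : factor_system R) :=
  fsect R.

Section CrossedProduct.
Variables (G : groupoid) (R : ring_bundle G) (F : factor_system R).

(* The pairs (x, y) of composable elements with r(x) = u and s(y) = w. *)
Definition cpair (u w : obj G) : choiceType :=
  {classic {v : obj G & (hom u v * hom v w)%type}}.

Definition cmul (u w : obj G) (p : cpair u w) : hom u w :=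
  let: existT v (x, y) := p in (x * y)%gpd.

(* The summand f(x) M_x(g(y)) tau(x, y). *)
Definition cterm (f g : fsect R) (u w : obj G) (p : cpair u w) : R u :=
  let: existT v (x, y) := p in
  coef f x * fsM F x (coef g y) * uval (fstau F x y).

Definition cp_coef (f g : fsect R) (u w : obj G) (z : hom u w) : R u :=
  \sum_(p \in [set p : cpair u w | cmul p = z]) cterm f g p.

(* Rewriting of the convolution sum as a sum over x alone, with y = x^-1 z. *)
Definition fan (u : obj G) : choiceType := {classic {v : obj G & hom u v}}.

Definition dterm (f g : fsect R) u w (z : hom u w) (a : fan u) : R u :=
  let x := projT2 a in
  coef f x * fsM F x (coef g (x^-1 * z)%gpd) * uval (fstau F x (x^-1 * z)%gpd).

Lemma ginvKl (u v w : obj G) (x : hom u v) (z : hom u w) : (x * (x^-1 * z))%gpd = z.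
Proof. by rewrite gmulA gmulgV gmul1g. Qed.

Lemma ginvKr (u v w : obj G) (x : hom u v) (y : hom v w) : (x^-1 * (x * y))%gpd = y.
Proof. by rewrite gmulA gmulVg gmul1g. Qed.

Lemma cp_coefE f g u w (z : hom u w) :
  cp_coef f g z = \sum_(a \in [set: fan u]) dterm f g z a.
Proof.
pose k (a : fan u) : cpair u w :=
  existT _ (projT1 a) (projT2 a, ((projT2 a)^-1 * z)%gpd).
rewrite /cp_coef (@reindex_fsbig _ _ _ _ _ k [set: fan u]) //; split.
- by move=> [v x] _; apply: ginvKl.
- move=> [v x] [v' x'] _ _ /(congr1 (fun p : cpair u w =>
    existT (hom u) (projT1 p) (projT2 p).1)).
  by [].
- move=> [v [x y]] /=; rewrite /cmul /= => xy.
  by exists (existT _ v x) => //; rewrite /k /= -xy ginvKr.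
Qed.

Lemma dtermf0 f g u w (z : hom u w) (a : fan u) :
  coef f (projT2 a) = 0 -> dterm f g z a = 0.
Proof. by rewrite /dterm => ->; rewrite !mul0r. Qed.

Lemma cp_coef_seq f g u w (z : hom u w) (r : seq (fan u)) : uniq r ->
  (forall a : fan u, coef f (projT2 a) <> 0 -> a \in r) ->
  cp_coef f g z = \sum_(a <- r) dterm f g z a.
Proof.
move=> ur fr; rewrite cp_coefE (@fsbigE _ _ _ _ _ r) //.
  by apply: eq_bigl => a; rewrite in_setT.
move=> a _ ar; apply: dtermf0; apply: contrapT => /fr.
by rewrite (negPf ar).
Qed.

Lemma fan_fin (f : fsect R) u : finite_set [set a : fan u | coef f (projT2 a) <> 0].
Proof.
have := coef_fin f.
pose k (a : fan u) : arrow G := existT _ u a.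
apply: (@finite_preimage _ _ _ k) => a b _ _; rewrite /k.
by move=> e; have := projT2_eq e; rewrite (Prop_irrelevance (projT1_eq e) erefl).
Qed.

Lemma fan_seq u (A : set (fan u)) : finite_set A ->
  exists2 r : seq (fan u), uniq r & forall a, A a -> a \in r.
Proof.
move=> fA; exists (finmap.enum_fset (fset_set A)) => [|a Aa]; first exact: finmap.fset_uniq.
by rewrite in_fset_set // inE.
Qed.

Definition acomp (a b : arrow G) : arrow G :=
  match pselect (projT1 (projT2 a) = projT1 b) with
  | left e => arr (projT2 (projT2 a) *
      eq_rect_r (fun v => hom v (projT1 (projT2 b))) (projT2 (projT2 b)) e)%gpd
  | right _ => a
  end.

Lemma acompE (u v w : obj G) (x : hom u v) (y : hom v w) :
  acomp (arr x) (arr y) = arr (x * y)%gpd.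
Proof.
rewrite /acomp; case: pselect => //= e.
by rewrite (Prop_irrelevance e erefl).
Qed.

Lemma cp_coef_fin f g : finite_set (supp (cp_coef f g)).
Proof.
have := finite_image2 acomp (coef_fin f) (coef_fin g).
apply: sub_finite_set => -[u [w z]]; rewrite /supp /= => ne.
apply: contrapT => no; apply: ne; rewrite cp_coefE.
apply: fsbig1 => -[v x] _; rewrite /dterm /=.
have [->|/eqP fx] := eqVneq (coef f x) 0; first by rewrite !mul0r.
have [->|/eqP gx] := eqVneq (coef g (x^-1 * z)%gpd) 0.
  by rewrite rmorph0 mulr0 mul0r.
exfalso; apply: no; exists (arr x) => //; exists (arr (x^-1 * z)%gpd) => //.
by rewrite acompE ginvKl.
Qed.

Definition cp_mul (f g : fsect R) : fsect R := FSect (cp_coef_fin f g).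

Let cp_mulDl : left_distributive cp_mul +%R.
Proof.
move=> f g h; apply: fsect_eq => u w z /=.
have [r ur rP] : exists2 r : seq (fan u), uniq r & forall a, 
    coef f (projT2 a) <> 0 \/ coef g (projT2 a) <> 0 -> a \in r.
  have [] // := @fan_seq u ([set a | coef f (projT2 a) <> 0] `|`
     [set a | coef g (projT2 a) <> 0]); last by move=> r; exists r.
  by rewrite finite_setU; split; apply: fan_fin.
have rfg (a : fan u) : coef (f + g) (projT2 a) <> 0 -> a \in r.
  rewrite coefD => ne; apply: rP; apply/not_andP => -[e1 e2].
  by apply: ne; rewrite e1 e2 addr0.
have rf (a : fan u) : coef f (projT2 a) <> 0 -> a \in r.
  by move=> ?; apply: rP; left.
have rg (a : fan u) : coef g (projT2 a) <> 0 -> a \in r.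
  by move=> ?; apply: rP; right.
rewrite !(@cp_coef_seq _ _ _ _ _ r) //.
by rewrite -big_split; apply: eq_bigr => a _ /=; rewrite /dterm coefD !mulrDl.
Qed.

Let cp_mulDr : right_distributive cp_mul +%R.
Proof.
move=> f g h; apply: fsect_eq => u w z /=.
have [r ur rP] := fan_seq (fan_fin f u).
rewrite !(@cp_coef_seq _ _ _ _ _ r) // -big_split; apply: eq_bigr => a _ /=.
by rewrite /dterm coefD rmorphD mulrDr mulrDl.
Qed.

Let assoc_term (u v w t : obj G) (x : hom u v) (y : hom v w) (z : hom w t)
    (a : R u) (b : R v) (c : R w) :
  a * fsM F x b * uval (fstau F x y) * fsM F (x * y)%gpd c
    * uval (fstau F (x * y)%gpd z) =
  a * fsM F x (b * fsM F y c * uval (fstau F y z))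
    * uval (fstau F x (y * z)%gpd).
Proof.
rewrite !rmorphM fsMM -!mulrA; congr (_ * (_ * (_ * (_ * _)))).
by rewrite -fstauA !mulrA uvalVl mul1r.
Qed.

Let cp_mulA : associative cp_mul.
Proof.
move=> f g h; apply: fsect_eq => u t z /=.
have [rf urf rfP] := fan_seq (fan_fin f u).
pose tr v (x : hom u v) (b : fan v) : fan u :=
  existT _ (projT1 b) (x * projT2 b)%gpd.
pose B : set (fan u) := \bigcup_(a in [set` rf])
  (tr _ (projT2 a) @` [set b : fan (projT1 a) | coef g (projT2 b) <> 0]).
have Bfin : finite_set B.
  apply: bigcup_finite; first exact: finite_seq.
  by move=> a _; apply: finite_image; apply: fan_fin.
have [r ur rP] := fan_seq Bfin.
have gB v (x : hom u v) w (y : hom u w) : coef f x <> 0 ->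
   coef g (x^-1 * y)%gpd <> 0 -> (existT _ w y : fan u) \in r.
  move=> fx gy; apply: rP; exists (existT _ v x); first exact: rfP.
  by exists (existT _ w (x^-1 * y)%gpd) => //; rewrite /tr /= ginvKl.
rewrite [RHS](@cp_coef_seq _ _ _ _ _ r) //; last first.
  move=> [w y] /= ne; apply: contrapT => nr; apply: ne.
  rewrite cp_coefE; apply: fsbig1 => -[v x] _; rewrite /dterm /=.
  have [->|/eqP fx] := eqVneq (coef f x) 0; first by rewrite !mul0r.
  have [->|/eqP gx] := eqVneq (coef g (x^-1 * y)%gpd) 0.
    by rewrite rmorph0 mulr0 mul0r.
  by case: nr; apply: gB gx.
rewrite (@cp_coef_seq _ _ _ _ _ rf) //.
have -> : \sum_(b <- r) dterm (cp_mul f g) h z b =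
  \sum_(b <- r) \sum_(a <- rf) (dterm f g (projT2 b) a
     * fsM F (projT2 b) (coef h ((projT2 b)^-1 * z)%gpd)
     * uval (fstau F (projT2 b) ((projT2 b)^-1 * z)%gpd)).
  apply: eq_bigr => b _; rewrite /dterm /= (@cp_coef_seq _ _ _ _ _ rf) //.
  by rewrite !mulr_suml.
rewrite exchange_big /=; apply: eq_bigr => -[v x] _.
have [fx0|/eqP fx] := eqVneq (coef f x) 0.
  by rewrite dtermf0 // big1 // => b _; rewrite dtermf0 // !mul0r.
pose ti (b : fan u) : fan v := existT _ (projT1 b) (x^-1 * projT2 b)%gpd.
have ti_inj : injective ti.
  move=> [w y] [w' y'] /(congr1 (tr _ x)); rewrite /tr /ti /=.
  by rewrite !ginvKl.
rewrite {1}/dterm /= (@cp_coef_seq _ _ _ _ _ (map ti r)); last first.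
- move=> [w y] /= gy; apply/mapP; exists (existT _ w (x * y)%gpd).
    by apply: (gB _ x) => //; rewrite ginvKr.
  by rewrite /ti /= ginvKr.
- by rewrite map_inj_uniq.
rewrite big_map rmorph_sum mulr_sumr mulr_suml; apply: eq_bigr => -[w y] _.
rewrite /dterm /=.
set y' := (x^-1 * y)%gpd.
have -> : y = (x * y')%gpd by rewrite /y' ginvKl.
rewrite (_ : (x^-1 * z)%gpd = (y' * ((x * y')^-1 * z))%gpd); last first.
  by rewrite -{1}[z](ginvKl (x * y')%gpd) -gmulA ginvKr.
by rewrite ginvKr assoc_term.
Qed.

HB.instance Definition _ := GRing.Zmodule.on (cprod F).
HB.instance Definition _ :=
  Zmodule_isRng.Build (cprod F) cp_mulA cp_mulDl cp_mulDr.

End CrossedProduct.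

Section Equivalence.
Variables (G : groupoid) (R : ring_bundle G).

Definition component (F : factor_system R) (a : arrow G) : set (cprod F) :=
  [set f | supp (@coef G R f) `<=` [set a]].

(* The subring identified with the direct sum of the fibres. *)
Definition coeff_ring (F : factor_system R) : set (cprod F) :=
  [set f | supp (@coef G R f) `<=` @unit_space G].

Arguments component F a : clear implicits.
Arguments coeff_ring F : clear implicits.

(* Both crossed products have the same underlying set [fsect R], in which the
   elements supported in the unit space form the same copy of the coefficient
   ring; this is the sense of the last condition. *)
Definition is_equivalence (F F' : factor_system R) (phi : cprod F -> cprod F') :
    Prop :=
  [/\ rng_iso phi,
      forall a : arrow G, phi @` component F a = component F' a &
      forall f : cprod F, coeff_ring F f -> phi f = f :> fsect R].

Definition equivalent (F F' : factor_system R) : Prop :=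
  exists phi : cprod F -> cprod F', is_equivalence phi.

Lemma twist_fin (h : cochain1 R) (f : fsect R) :
  finite_set (supp (fun u v (x : hom u v) => coef f x * uval (c1val h x))).
Proof.
apply: sub_finite_set (coef_fin f) => a.
by rewrite /supp /=; apply: contra_not => ->; rewrite mul0r.
Qed.

Definition psi (F F' : factor_system R) (h : cochain1 R) (f : cprod F') :
  cprod F := FSect (twist_fin h f).

End Equivalence.

Arguments psi {G R} F F' h f.

(* Main.v *)
Require Import Defs.
From mathcomp Require Import all_boot all_algebra.
From mathcomp Require Import all_classical.

(** Write [n_x] for the homogeneous element with value [n] at the arrow [x].
    In a crossed product these multiply by [a_x b_y = (a M_x(b) tau(x,y))_(xy)],
    and every element is a finite sum of them.

    A 1-cochain [h] with [F' = h.F] gives an equivalence because, in the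
    product formula for [h.F], the inner factors [h(x)^-1 h(x)] cancel and the
    last factor [h(xy)^-1] is exactly what right multiplication by [h] removes
    ([psi_equivalence]).

    Conversely let [phi] be an equivalence from the crossed product by [F'] to
    the one by [F].  Since [phi] fixes the coefficients, it is left linear over
    them: as [n_x = n_r(x) 1_x], the value of [phi(n_x)] at [x] is [n h(x)],
    where [h(x)] is the value of [phi(1_x)] at [x].  As [phi] maps the component
    at [x] bijectively onto itself, [n |-> n h(x)] is a bijection of the fibre,
    which forces [h(x)] to be a unit ([unit_of_bij_mulr]).  So [phi] is right
    multiplication by [h].  Applying [phi] to the products [1_x n_s(x)] and
    [1_x 1_y] gives [M'_x(n) h(x) = h(x) M_x(n)] and
    [tau'(x,y) h(xy) = h(x) M_x(h(y)) tau(x,y)], that is, [F' = h.F]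
    ([act_of_mul_psi]).

    The first part of the theorem follows because the inverse of an equivalence
    is an equivalence. *)

Set Implicit Arguments.
Unset Strict Implicit.
Unset Printing Implicit Defensive.
Import GRing.Theory.
Local Open Scope classical_set_scope.
Local Open Scope ring_scope.

Local Notation hom := Defs.hom.

(** * Units and factor systems *)

Lemma mulr_uvalK (A : pzRingType) (h : units A) (a : A) :
  a * uval h * uval h^-1%g = a.
Proof. by rewrite -mulrA uvalVr mulr1. Qed.

Lemma mulr_uvalVK (A : pzRingType) (h : units A) (a : A) :
  a * uval h^-1%g * uval h = a.
Proof. by rewrite -mulrA uvalVl mulr1. Qed.

(** Surjectivity gives a left inverse [m] of [b]; it is also a right inverse
    because [(b m) b = 1 b] and right multiplication by [b] is injective. *)
Lemma unit_of_bij_mulr (A : pzRingType) (b : A) :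
  injective (fun a => a * b) -> (exists m, m * b = 1) ->
  exists h : units A, uval h = b.
Proof.
move=> binj [m mb]; have bm : b * m = 1.
  by apply: binj; rewrite -mulrA mb mulr1 mul1r.
by exists (mkUnits bm mb).
Qed.

Lemma factor_system_eq (G : groupoid) (R : ring_bundle G)
    (F F' : factor_system R) :
  (forall u v (x : hom u v) n, fsM F x n = fsM F' x n) ->
  (forall u v w (x : hom u v) (y : hom v w),
     uval (fstau F x y) = uval (fstau F' x y)) ->
  F = F'.
Proof.
case: F F' => [M t a1 a2 a3 a4 a5] [M' t' b1 b2 b3 b4 b5] /= eM et.
have eM' : M = M'.
  do 3! (apply: functional_extensionality_dep => ?).
  by apply: ring_iso_eq => n; apply: eM.
have et' : t = t'.
  do 5! (apply: functional_extensionality_dep => ?).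
  by apply: uval_inj; apply: et.
by subst; congr FactorSystem; apply: Prop_irrelevance.
Qed.

Definition cochain1_inv (G : groupoid) (R : ring_bundle G) (h : cochain1 R) :
  cochain1 R.
Proof.
by exists (fun u v (x : hom u v) => (c1val h x)^-1%g) => u; rewrite c1val1 invg1.
Defined.

(** * Homogeneous elements *)

Lemma existT_inj2 (I : Type) (T : I -> Type) i (x y : T i) :
  existT T i x = existT T i y -> x = y.
Proof.
by move=> e; have := projT2_eq e; rewrite (Prop_irrelevance (projT1_eq e) erefl).
Qed.

(** The endpoints of [x] and [y] agree only propositionally, so that neither can
    be rewritten into the other; a predicate on all arrows is transported. *)
Lemma arr_eq_ind (G : groupoid) (P : forall u v : obj G, hom u v -> Prop)
    u v (x : hom u v) u' v' (y : hom u' v') :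
  arr x = arr y -> P u v x -> P u' v' y.
Proof.
move=> e Px.
exact: (eq_ind (arr x) (fun a : arrow G => P _ _ (projT2 (projT2 a))) Px _ e).
Qed.

Section Homogeneous.
Variables (G : groupoid) (R : ring_bundle G).
Implicit Types (f g : fsect R) (a : arrow G).

(** The arrow carries its endpoints, so that the only transport needed is
    along an equality of arrows. *)
Definition single_coef a (n : R (projT1 a)) (u v : obj G) (y : hom u v) : R u :=
  match pselect (a = arr y) with
  | left e => eq_rect a (fun b : arrow G => R (projT1 b)) n (arr y) e
  | right _ => 0
  end.

Lemma single_coef_id u v (x : hom u v) (n : R u) :
  @single_coef (arr x) n _ _ x = n.
Proof.
rewrite /single_coef; case: pselect => // e.
by rewrite (Prop_irrelevance e erefl).
Qed.

Lemma single_coef_neq a (n : R (projT1 a)) u v (y : hom u v) :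
  a <> arr y -> single_coef n y = 0.
Proof. by rewrite /single_coef; case: pselect. Qed.

Lemma single_supp a (n : R (projT1 a)) : supp (single_coef n) `<=` [set a].
Proof.
move=> -[u [v y]]; rewrite /supp /= => ne; apply: contrapT => na; apply: ne.
by apply: single_coef_neq => e; apply: na.
Qed.

Definition single_at a (n : R (projT1 a)) : fsect R :=
  FSect (sub_finite_set (@single_supp a n) (finite_set1 a)).

Definition single u v (x : hom u v) (n : R u) : fsect R := @single_at (arr x) n.

Lemma coef_single u v (x : hom u v) (n : R u) : coef (single x n) x = n.
Proof. exact: single_coef_id. Qed.

Lemma coef_single_neq u v (x : hom u v) (n : R u) u' v' (y : hom u' v') :
  arr x <> arr y -> coef (single x n) y = 0.
Proof. exact: single_coef_neq. Qed.

Lemma component_single f u v (x : hom u v) :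
  supp (@coef G R f) `<=` [set arr x] -> f = single x (coef f x).
Proof.
move=> fx; apply: fsect_eq => u' v' y.
have [exy|nxy] := pselect (arr x = arr y).
  apply: (arr_eq_ind (P := fun _ _ y => coef f y = coef (single x _) y) exy).
  by rewrite coef_single.
rewrite coef_single_neq //; apply: contrapT => fy.
exact: nxy (esym (fx (arr y) fy)).
Qed.

Lemma coef_sum (I : Type) (r : seq I) (g : I -> fsect R) u v (x : hom u v) :
  coef (\sum_(i <- r) g i) x = \sum_(i <- r) coef (g i) x.
Proof. by elim/big_rec2: _ => // i s t _ <-. Qed.

Lemma fsect_sum_single f : exists r : seq (arrow G),
  f = \sum_(a <- r) single (projT2 (projT2 a)) (coef f (projT2 (projT2 a))).
Proof.
exists (finmap.enum_fset (fset_set (supp (@coef G R f)))).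
set r := finmap.enum_fset _.
have memr a : (a \in r) = (a \in supp (@coef G R f)).
  by rewrite /r in_fset_set //; exact: coef_fin.
apply: fsect_eq => u v x; rewrite coef_sum.
have vanish (a : arrow G) : a != arr x ->
    coef (single (projT2 (projT2 a)) (coef f (projT2 (projT2 a)))) x = 0.
  by case: a => ? [? ?] /eqP ne; apply: coef_single_neq.
have [xr|xr] := boolP ((arr x : arrow G) \in r).
  rewrite (bigD1_seq (arr x : arrow G)) //=; last exact: finmap.fset_uniq.
  by rewrite single_coef_id big1 ?addr0 // => a; apply: vanish.
have -> : coef f x = 0.
  apply: contrapT => fx; move/negP: xr; apply.
  by rewrite memr inE.
rewrite big_seq big1 // => a ar; apply: vanish.
by apply: contraNneq xr => <-.
Qed.

(** Every element is a finite sum of homogeneous ones. *)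
Lemma additive_ext (phi chi : fsect R -> fsect R) :
  {morph phi : f g / f + g} -> {morph chi : f g / f + g} ->
  (forall u v (x : hom u v) n, phi (single x n) = chi (single x n)) ->
  phi =1 chi.
Proof.
move=> phiD chiD phichi f.
have add0 (k : fsect R -> fsect R) : {morph k : f g / f + g} -> k 0 = 0.
  by move=> kD; apply: (@addrI _ (k 0)); rewrite -kD !addr0.
have [r ->] := fsect_sum_single f.
rewrite (big_morph phi phiD (add0 _ phiD)) (big_morph chi chiD (add0 _ chiD)).
by apply: eq_bigr => a _; apply: phichi.
Qed.

(** * Products with a homogeneous left factor *)

Variable F : factor_system R.

(** In the convolution sum only the factorisation with first factor [x]
    survives. *)
Lemma coef_single_mul u v w (x : hom u v) (y : hom v w) (a : R u) g :
  coef (cp_mul F (single x a) g) (x * y)%gpd =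
  a * fsM F x (coef g y) * uval (fstau F x y).
Proof.
rewrite /= (@cp_coef_seq _ _ _ _ _ _ _ _ [:: existT _ v x : fan u]) //.
  by rewrite big_seq1 /dterm coef_single ginvKr.
move=> [v' x'] /= ne; rewrite inE; apply/eqP; apply: contrapT => nx; apply: ne.
by apply: coef_single_neq => e; apply: nx; rewrite -(existT_inj2 e).
Qed.

Lemma coef_single_one_mul u w (y : hom u w) (n : R u) g :
  coef (cp_mul F (single (gone u) n) g) y = n * coef g y.
Proof. by rewrite -{1}[y]gmul1g coef_single_mul fsM1 fstau1g mulr1. Qed.

Lemma single_one_mul u v (x : hom u v) (n : R u) :
  cp_mul F (single (gone u) n) (single x 1) = single x n.
Proof.
apply: fsect_eq => u' w y.
have [exy|nxy] := pselect (arr x = arr y).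
  apply: (arr_eq_ind (P := fun _ _ y =>
    coef (cp_mul F _ (single x 1)) y = coef (single x n) y) exy).
  by rewrite coef_single_one_mul !coef_single mulr1.
rewrite [RHS]coef_single_neq //; have [eu|nu] := pselect (u = u').
  by subst u'; rewrite coef_single_one_mul coef_single_neq // mulr0.
rewrite /= cp_coefE; apply: fsbig1 => -[v' x'] _; apply: dtermf0.
by apply: coef_single_neq => /(congr1 (@projT1 _ _)).
Qed.

End Homogeneous.

(** * Equivalences and cochains *)

Section Equivalences.
Variables (G : groupoid) (R : ring_bundle G).
Implicit Types (F : factor_system R) (h : cochain1 R).

Lemma equivalent_sym F F' : equivalent F F' -> equivalent F' F.
Proof.
case=> phi [[phiD phiM [chi phiK chiK]] phiC phi1]; exists chi; split.
- split; last by exists phi.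
  + by move=> f g; rewrite -{1}[f]chiK -{1}[g]chiK -phiD phiK.
  + by move=> f g; rewrite -{1}[f]chiK -{1}[g]chiK -phiM phiK.
- move=> a; rewrite -phiC; apply/seteqP; split=> [f [_ [g ga <-] <-]|f fa].
    by rewrite phiK.
  by exists (phi f); [exists f | rewrite phiK].
- by move=> f f1; rewrite -[RHS](phiK f) (phi1 f f1).
Qed.

Lemma psiK F F' h : cancel (psi F F' h) (psi F' F (cochain1_inv h)).
Proof. by move=> f; apply: fsect_eq => u v x /=; rewrite mulr_uvalK. Qed.

Lemma psiVK F F' h : cancel (psi F' F (cochain1_inv h)) (psi F F' h).
Proof. by move=> f; apply: fsect_eq => u v x /=; rewrite mulr_uvalVK. Qed.

Lemma psiD F F' h : {morph psi F F' h : f g / f + g}.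
Proof. by move=> f g; apply: fsect_eq => u v x /=; rewrite mulrDl. Qed.

Lemma psi_supp F F' h (f : cprod F') :
  supp (@coef G R (psi F F' h f)) `<=` supp (@coef G R f).
Proof. by move=> a; rewrite /supp /=; apply: contra_not => ->; rewrite mul0r. Qed.

Lemma psi_single F F' h u v (x : hom u v) (n : R u) :
  psi F F' h (single x n) = single x (n * uval (c1val h x)).
Proof.
rewrite [LHS](@component_single _ _ _ _ _ x).
  by congr single; rewrite /= single_coef_id.
by apply: (subset_trans (@psi_supp F F' h _)); apply: single_supp.
Qed.

(** The identity holds summand by summand over the factorisations
    [z = x (x^-1 z)]. *)
Lemma psiM F h :
  {morph psi F (act h F) h : f g / rngmul f g}.
Proof.
move=> f g; apply: fsect_eq => u w z /=.
have [r ur rf] := fan_seq (fan_fin f u).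
rewrite !(@cp_coef_seq _ _ _ _ _ _ _ _ r) //; last first.
  move=> a ne; apply: rf; move: ne => /=; apply: contra_not => ->.
  by rewrite mul0r.
rewrite mulr_suml; apply: eq_bigr => -[v x] _; rewrite /dterm /=.
set y := (x^-1 * z)%gpd; rewrite -(ginvKl x z) -/y.
rewrite /conj_fun /acttau !uvalM rmorphM !mulrA.
by rewrite !mulr_uvalVK.
Qed.

Lemma psi_equivalence F h : is_equivalence (psi F (act h F) h).
Proof.
split; first split.
- exact: psiD.
- exact: psiM.
- by exists (psi (act h F) F (cochain1_inv h)); [apply: psiK | apply: psiVK].
- move=> a; apply/seteqP; split=> [_ [f fa <-]|f fa].
    exact: subset_trans (@psi_supp _ _ _ _) fa.
  exists (psi (act h F) F (cochain1_inv h) f); last exact: psiVK.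
  exact: subset_trans (@psi_supp _ _ _ _) fa.
- move=> f f1; apply: fsect_eq => u v x /=.
  have [->|/eqP fx] := eqVneq (coef f x) 0; first by rewrite mul0r.
  have [t _ ext] := f1 (arr x) fx.
  apply: (arr_eq_ind (P := fun _ _ x =>
    coef f x * uval (c1val h x) = coef f x) ext).
  by rewrite c1val1 mulr1.
Qed.

(** Comparing the coefficients at [x] of the images of [1_x n_s(x)] expresses
    [M'] through [M] and [h]; the coefficients at [xy] for [1_x 1_y] do the same
    for [tau']. *)
Lemma act_of_mul_psi F F' h :
  {morph psi F F' h : f g / rngmul f g} -> F' = act h F.
Proof.
move=> hM.
(* The coefficient at [xy] of the image of [1_x n_y]. *)
have key u v w (x : hom u v) (y : hom v w) (n : R v) :
    fsM F' x n * uval (fstau F' x y) * uval (c1val h (x * y)%gpd) =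
    uval (c1val h x) * fsM F x (n * uval (c1val h y)) * uval (fstau F x y).
  have := congr1 (fun f => coef f (x * y)%gpd) (hM (single x 1) (single y n)).
  rewrite (psi_single _ _ _ x) mul1r.
  have := coef_single_mul F' x y 1 (single y n) => /= ->.
  have := coef_single_mul F x y (uval (c1val h x)) (psi F F' h (single y n)).
  move=> /= ->.
  by rewrite !single_coef_id mul1r.
apply: factor_system_eq => [u v x n|u v w x y] /=.
  have := key _ _ _ x (gone v) n.
  rewrite !fstaug1 gmulg1 c1val1 !uval1 !mulr1 => e.
  by rewrite /conj_fun -e mulr_uvalK.
have := key _ _ _ x y 1; rewrite rmorph1 !mul1r => e.
by rewrite /acttau !uvalM -[RHS]/(_ * fsM F x _ * _ * _) -e mulr_uvalK.
Qed.

Section FromEquivalence.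
Variables (F F' : factor_system R) (phi : cprod F' -> cprod F).
Hypothesis phiE : is_equivalence phi.

Lemma equivalence_component u v (x : hom u v) (f : cprod F') :
  supp (@coef G R f) `<=` [set arr x] ->
  supp (@coef G R (phi f)) `<=` [set arr x].
Proof.
move=> fx; case: phiE => _ phiC _.
by suff : @component G R F (arr x) (phi f) by []; rewrite -phiC; exists f.
Qed.

Lemma equivalence_single_one u (n : R u) :
  phi (single (gone u) n) = single (gone u) n.
Proof.
case: phiE => _ _ phi1; apply: phi1 => a /single_supp ->.
by exists u.
Qed.

(** Apply [phi] to [n_x = n_r(x) 1_x]. *)
Lemma equivalence_single u v (x : hom u v) (n : R u) :
  phi (single x n) = single x (n * coef (phi (single x 1)) x).
Proof.
have [[_ phiM _] _ _] := phiE.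
rewrite [LHS](@component_single _ _ _ _ _ x); last first.
  by apply: equivalence_component; apply: single_supp.
congr single.
have e : phi (single x n) = cp_mul F (single (gone u) n) (phi (single x 1)).
  have := phiM (single (gone u) n) (single x 1).
  rewrite equivalence_single_one; apply: etrans.
  by congr phi; apply: (esym (single_one_mul F' x n)).
by rewrite e; apply: coef_single_one_mul.
Qed.

Lemma equivalence_unit u v (x : hom u v) :
  exists h : units (R u), uval h = coef (phi (single x 1)) x.
Proof.
have [[_ _ [chi phiK _]] phiC _] := phiE.
(* [phi] restricts to [n_x |-> (n c)_x] on the component at [x], where [c] is
   the value of [phi(1_x)] at [x]. *)
apply: unit_of_bij_mulr => [a b /= ab|].
  have : phi (single x a) = phi (single x b).
    by rewrite (equivalence_single x a) (equivalence_single x b) ab.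
  by move/(can_inj phiK)/(congr1 (fun f => coef f x)); rewrite !coef_single.
have : @component G R F (arr x) (single x 1) by exact: single_supp.
rewrite -phiC => -[f fx fe]; exists (coef f x).
move: fe; rewrite {1}(component_single fx) equivalence_single.
by move/(congr1 (fun f => coef f x)); rewrite !coef_single.
Qed.

Lemma equivalence_psi : exists h, F' = act h F /\ phi = psi F F' h.
Proof.
have [[phiD phiM _] _ _] := phiE.
pose k u v (x : hom u v) := sval (cid (equivalence_unit x)).
have kE u v (x : hom u v) : uval (k u v x) = coef (phi (single x 1)) x.
  exact: svalP (cid (equivalence_unit x)).
have k1 u : k u u (gone u) = 1%g.
  by apply: uval_inj; rewrite kE equivalence_single_one coef_single.
pose h := Cochain1 k1; exists h.
have e : phi = psi F F' h.
  apply/funext; apply: additive_ext phiD (@psiD F F' h) _ => u v x n.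
  by rewrite equivalence_single psi_single kE.
by split=> //; apply: act_of_mul_psi; rewrite -e.
Qed.

End FromEquivalence.
End Equivalences.

Theorem proposition5p3 (G : groupoid) (R : ring_bundle G)
    (F F' : factor_system R) :
  (equivalent F F' <-> cohomologous F F') /\
  (forall h : cochain1 R, F' = act h F -> is_equivalence (psi F F' h)) /\
  (forall phi : cprod F' -> cprod F, is_equivalence phi ->
     exists h : cochain1 R, F' = act h F /\ phi = psi F F' h).
Proof.
split; last first.
  by split=> [h ->|phi]; [apply: psi_equivalence | apply: equivalence_psi].
split=> [/equivalent_sym[phi /equivalence_psi[h [e _]]]|[h ->]].
  by exists h.
by apply: equivalent_sym; exists (psi F (act h F) h); apply: psi_equivalence.
Qed.
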